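(* Let $\Omega=\{(q_1,q_2)\in\mathbb{R}^2 : q_1>q_2\}$ and let $g$ be the Riemannian metric on $\Omega$ whose matrix in the coordinates $(q_1,q_2)$ is $$g_{ij}=\frac{1}{1-e^{-2(q_1-q_2)}}(-1)^{i+j}e^{-|q_i-q_j|},\qquad i,j\in\{1,2\}.$$ Then the Gauss curvature $\kappa_g$ of $g$ in $\Omega$ satisfies $$\kappa_g=\frac{e^{(q_1-q_2)}-2}{e^{2(q_1-q_2)}+2e^{(q_1-q_2)}+1}.$$ In particular, $\kappa_g>0$ if $q_1-q_2>\ln 2$, $\kappa_g=0$ if $q_1-q_2=\ln 2$, and $\kappa_g<0$ if $q_1-q_2<\ln 2$.
   Context: The metric $g=\sum_{i,j}g_{ij}\,dq_i\,dq_j$ is the inverse of the positive definite matrix $E(q)=(e^{-|q_i-q_j|})_{i,j=1,2}$. *)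

(* Defs.v *)
From HB Require Import structures.
From mathcomp Require Import all_boot all_order all_algebra.
From mathcomp Require Import ring lra.
From mathcomp Require Import all_classical all_reals all_analysis.

Set Implicit Arguments.
Unset Strict Implicit.
Unset Printing Implicit Defensive.

Import Order.TTheory GRing.Theory Num.Theory.
Import numFieldNormedType.Exports.

Local Open Scope classical_set_scope.
Local Open Scope ring_scope.

Definition partial (R : realType) (n : nat) (i : 'I_n) (f : 'rV[R]_n -> R) :
    'rV[R]_n -> R :=
  'D_(delta_mx 0 i) f.

(* C^k on U; meant for open U, where this is the usual notion. *)
Fixpoint Ck_on (R : realType) (n k : nat) (U : set 'rV[R]_n)
    (f : 'rV[R]_n -> R) : Prop :=
  match k with
  | 0 => forall q, U q -> {for q, continuous f}
  | k'.+1 => (forall q, U q -> differentiable f q) /\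
             (forall i, Ck_on k' U (partial i f))
  end.

Definition smooth_on (R : realType) (n : nat) (U : set 'rV[R]_n)
    (f : 'rV[R]_n -> R) : Prop :=
  forall k, Ck_on k U f.

(* A Riemannian metric on an open set of R^n, given by its matrix in the
   standard coordinates; the values of the matrix outside U are irrelevant. *)
Record riemannian_metric (R : realType) (n : nat) (U : set 'rV[R]_n) :=
  RiemannianMetric {
    metric_mx :> 'rV[R]_n -> 'M[R]_n;
    metric_open : open U;
    metric_smooth : forall i j, smooth_on U (fun q => metric_mx q i j);
    metric_sym : forall q, U q -> (metric_mx q)^T = metric_mx q;
    metric_pos : forall q, U q -> forall v : 'rV[R]_n, v != 0 ->
      0 < (v *m metric_mx q *m v^T) 0 0
  }.

Section curvature.
Context (R : realType) (n : nat) (U : set 'rV[R]_n) (g : riemannian_metric U).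

(* Gamma^k_{ij}, i.e. nabla_{d_i} d_j = \sum_k Gamma^k_{ij} d_k for the
   Levi-Civita connection nabla. *)
Definition christoffel (k i j : 'I_n) (q : 'rV[R]_n) : R :=
  2^-1 * \sum_(l < n) invmx (g q) k l *
    (partial i (fun x => g x j l) q + partial j (fun x => g x i l) q
     - partial l (fun x => g x i j) q).

(* The d_l component of R(d_i, d_j) d_k, with the sign convention
   R(X, Y) = nabla_X nabla_Y - nabla_Y nabla_X - nabla_[X, Y]. *)
Definition riemann (l i j k : 'I_n) (q : 'rV[R]_n) : R :=
  partial i (christoffel l j k) q - partial j (christoffel l i k) q
  + \sum_(m < n) (christoffel l i m q * christoffel m j k q
                  - christoffel l j m q * christoffel m i k q).

(* The inner product g(R(d_i, d_j) d_k, d_h). *)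
Definition riemann_low (i j k h : 'I_n) (q : 'rV[R]_n) : R :=
  \sum_(l < n) riemann l i j k q * g q l h.

End curvature.

(* The sectional curvature of the tangent plane,
   g(R(d_1, d_2) d_2, d_1) / (g_11 g_22 - g_12^2); indices are shifted to 0, 1.
   With this sign the round sphere has positive curvature. *)
Definition gauss_curvature (R : realType) (U : set 'rV[R]_2)
    (g : riemannian_metric U) (q : 'rV[R]_2) : R :=
  riemann_low g 0 1 1 0 q / \det (g q).

(* q 0 0 and q 0 1 are q_1 and q_2. *)
Definition Omega (R : realType) : set 'rV[R]_2 := [set q | q 0 0 > q 0 1].

Definition peakon_mx (R : realType) (q : 'rV[R]_2) : 'M[R]_2 :=
  \matrix_(i, j) (1 / (1 - expR (- 2 * (q 0 0 - q 0 1))) * (-1) ^+ (i + j)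
                  * expR (- `|q 0 i - q 0 j|)).

Section smoothness.
Context (R : realType).

Let L (q : 'rV[R]_2) : R := q 0 0 - q 0 1.

Let L_diff q : differentiable L q.
Proof. by apply: differentiableB; exact: differentiable_coord. Qed.

Lemma Omega_open : open (@Omega R).
Proof.
have -> : @Omega R = L @^-1` [set t | 0 < t].
  by apply/seteqP; split => q /=; rewrite /Omega /L /= subr_gt0.
apply: open_comp; last exact: open_gt.
by move=> q _; exact: differentiable_continuous (L_diff q).
Qed.

Let L_partial i q : partial i L q = (-1) ^+ i.
Proof.
have Llin : linear L by move=> a u v; rewrite /L !mxE /GRing.scale/=; ring.
pose LlinM := GRing.isLinear.Build _ _ _ _ _ Llin.
pose LL : {linear 'rV[R]_2 -> R} := HB.pack L LlinM.
have Lc : continuous LL.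
  by move=> x; exact: differentiable_continuous (L_diff x).
rewrite /partial deriveE//.
have -> : 'd L q = LL :> ('rV[R]_2 -> R) by exact: (@diff_lin _ _ _ LL).
rewrite /= /L !mxE /=.
case: i => -[|[|//]] ? /=; rewrite ?subr0 ?sub0r ?expr0 ?expr1//.
Qed.

Let partial_comp (h : R -> R) i q : derivable h (L q) 1 ->
  partial i (h \o L) q = (-1) ^+ i * h^`()%classic (L q).
Proof.
move=> dh; have dh' : differentiable h (L q) by exact/derivable1_diffP.
rewrite /partial deriveE; last exact: differentiable_comp.
rewrite diff_comp//= diff1E// -deriveE//.
by rewrite [_ *: _]/(_ * _) -/(partial i L q) L_partial.
Qed.

Let diff_near (f g : 'rV[R]_2 -> R) q : {near q, f =1 g} ->
  differentiable g q -> differentiable f q.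
Proof.
move=> fg dg; have fgq : f q = g q by exact: nbhs_singleton fg.
have [gc gE] := (diff_locallyP _ _).1 dg.
have fE : f \o shift q = cst (f q) + 'd g q +o_ 0 id.
  apply/eqaddoP => e e0; have /eqaddoP/(_ e e0) := gE.
  have fg0 : \forall h \near 0, f (h + q) = g (h + q).
    by move: fg; rewrite (near_shift 0) subr0.
  apply: filter_app; near=> h => /=; rewrite fgq.
  have E : f (h + q) = g (h + q) by near: h.
  by rewrite !fctE /= E.
have dfE := diff_unique gc fE.
by apply/diff_locallyP; rewrite dfE.
Unshelve. all: by end_near. Qed.

(* p(X) / (1 - X^2)^n with X = exp(-t): for t > 0 this family is closed under
   differentiation. *)
Let phi (p : {poly R}) (n : nat) (t : R) : R :=
  p.[expR (- t)] * ((1 - expR (- t) ^+ 2)^-1) ^+ n.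

Let next (p : {poly R}) (n : nat) : {poly R} :=
  - 'X * p^`() * (1 - 'X ^+ 2) - 2 *: ('X ^+ 2 * p) *+ n.

Let phi_derive p n (t : R) : 0 < t -> is_derive t (1 : R) (phi p n) (phi (next p n) n.+1 t).
Proof.
move=> t0.
have X1 : 1 - expR (- t) ^+ 2 != 0.
  rewrite subr_eq0 eq_sym lt_eqF// expr_lt1 ?expR_ge0//.
  by rewrite expR_lt1 oppr_lt0.
have HX : is_derive t (1 : R) (fun t : R => expR (- t)) (- expR (- t)).
  have -> : - expR (- t) = -1 * expR (- t) by rewrite mulN1r.
  rewrite mulrC; exact: (@is_derive1_comp _ expR -%R).
have Hp : is_derive t (1 : R) (fun t : R => p.[expR (- t)])
    (- expR (- t) * p^`().[expR (- t)]).
  rewrite mulrC; exact: (@is_derive1_comp _ (horner p) (fun t : R => expR (- t))).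
have HD : is_derive t (1 : R) (fun t : R => 1 - expR (- t) ^+ 2) (2 * expR (- t) ^+ 2).
  have H2 := is_deriveX 2 HX.
  have -> : (fun t : R => 1 - expR (- t) ^+ 2) =
      cst 1 - (fun t : R => expR (- t)) ^+ 2 by apply/funext => u; rewrite !fctE.
  apply: (is_derive_eq (is_deriveB (is_derive_cst (1 : R) t 1) H2)).
  rewrite /GRing.scale/=; ring.
have HV : is_derive t (1 : R) (fun t : R => (1 - expR (- t) ^+ 2)^-1)
    (- (1 - expR (- t) ^+ 2) ^- 2 * (2 * expR (- t) ^+ 2)).
  case: HD => D1 D2; apply: DeriveDef; first exact: derivableV.
  by rewrite deriveV// D2.
have HVn : is_derive t (1 : R) (fun t : R => ((1 - expR (- t) ^+ 2)^-1) ^+ n)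
    (n%:R * ((1 - expR (- t) ^+ 2)^-1) ^+ n.+1 * - (2 * expR (- t) ^+ 2)).
  case: (n) => [|m].
    rewrite !mul0r.
    have -> : (fun t : R => (1 - expR (- t) ^+ 2)^-1 ^+ 0) = cst 1.
      by apply/funext => u; rewrite expr0.
    exact: is_derive_cst.
  have -> : (fun t : R => (1 - expR (- t) ^+ 2)^-1 ^+ m.+1) =
      (fun t : R => (1 - expR (- t) ^+ 2)^-1) ^+ m.+1.
    by apply/funext => u; rewrite !fctE.
  apply: (is_derive_eq (is_deriveX m.+1 HV)).
  rewrite /GRing.scale/= !exprS expr0 !invfM ?invr1; ring.
have -> : phi p n = (fun t : R => p.[expR (- t)]) *
    (fun t : R => (1 - expR (- t) ^+ 2)^-1 ^+ n).
  by apply/funext => u; rewrite !fctE.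
apply: (is_derive_eq (is_deriveM Hp HVn)).
have nextE x : (next p n).[x] =
    - x * p^`().[x] * (1 - x * (x * 1)) - n%:R * (2 * (x * (x * 1) * p.[x])).
  rewrite /next !(hornerD, hornerN, hornerM, hornerX, hornerXn, hornerC).
  by rewrite hornerMn hornerZ hornerM hornerXn [in RHS]mulr_natl !exprS expr0 !mulr1.
rewrite /phi nextE /GRing.scale/= !exprS !expr0.
set X := expR (- t); set W := (1 - X * (X * 1))^-1.
have XW : (1 - X * (X * 1)) * W = 1 by apply: mulfV; rewrite mulr1 -expr2.
set d := p^`().[X]; set Wn := W ^+ n.
apply/eqP; rewrite -subr_eq0; apply/eqP.
transitivity (- X * d * Wn * (1 - (1 - X * (X * 1)) * W)); first by ring.
by rewrite XW subrr mulr0.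
Qed.

Let phi_smooth k p n c f :
  (forall q, Omega q -> f q = c * phi p n (L q)) -> Ck_on k (@Omega R) f.
Proof.
have near_eq (c' : R) p' n' (f' : 'rV[R]_2 -> R) q :
    (forall x, Omega x -> f' x = c' * phi p' n' (L x)) -> Omega q ->
    {near q, f' =1 (fun t => c' * phi p' n' t) \o L}.
  move=> H Uq; have : \forall x \near q, Omega x.
    by apply: open_nbhs_nbhs; split=> //; exact: Omega_open.
  by apply: filterS => x /H.
have dphi (c' : R) p' n' (q : 'rV[R]_2) : Omega q ->
    is_derive (L q) (1 : R) (fun t => c' * phi p' n' t)
      (c' * phi (next p' n') n'.+1 (L q)).
  move=> Uq; apply: is_deriveZ; apply: phi_derive.
  by rewrite /L subr_gt0.
have df (c' : R) p' n' (f' : 'rV[R]_2 -> R) q :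
    (forall x, Omega x -> f' x = c' * phi p' n' (L x)) -> Omega q ->
    differentiable f' q.
  move=> H Uq; apply: (diff_near (near_eq _ _ _ _ _ H Uq)).
  apply: differentiable_comp => //; apply/derivable1_diffP.
  by have [] := dphi c' p' n' q Uq.
elim: k p n c f => [|k IH] p n c f Hf.
  by move=> q Uq; apply: differentiable_continuous; exact: df Hf Uq.
split=> [q Uq|i]; first exact: df Hf Uq.
apply: (IH (next p n) n.+1 ((-1) ^+ i * c)) => q Uq.
rewrite /partial (near_eq_derive _ (near_eq _ _ _ _ _ Hf Uq)).
have [D1 D2] := dphi c p n q Uq.
by rewrite -/(partial i _ q) partial_comp// derive1E D2 mulrA.
Qed.

Let ord2P (i : 'I_2) : {i = 0} + {i = 1}.
Proof. by case: i => -[|[|//]] Hi; [left|right]; exact: val_inj. Qed.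

Lemma peakon_mxE (q : 'rV[R]_2) (i j : 'I_2) : Omega q ->
  peakon_mx q i j = (-1) ^+ (i + j) *
    phi (if i == j then 1 else 'X) 1 (L q).
Proof.
move=> Uq; rewrite mxE /phi /L.
have -> : expR (- 2 * (q 0 0 - q 0 1)) = expR (- (q 0 0 - q 0 1)) ^+ 2.
  by rewrite -expRM_natl; congr expR; ring.
rewrite mul1r expr1.
have [->|ij] := eqVneq i j.
  by rewrite subrr normr0 oppr0 expR0 hornerC; ring.
have -> : `|q 0 i - q 0 j| = q 0 0 - q 0 1.
  have q10 : 0 < q 0 0 - q 0 1 by rewrite subr_gt0.
  move: ij; case: (ord2P i) => ->; case: (ord2P j) => ->; rewrite ?eqxx// => _.
    by rewrite gtr0_norm.
  by rewrite distrC gtr0_norm.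
by rewrite hornerX; ring.
Qed.

Lemma peakon_mx_smooth i j : smooth_on (@Omega R) (fun q => peakon_mx q i j).
Proof. by move=> k; apply: phi_smooth => q /peakon_mxE->. Qed.

Lemma peakon_mx_sym (q : 'rV[R]_2) : (peakon_mx q)^T = peakon_mx q.
Proof. by apply/matrixP => i j; rewrite !mxE addnC distrC. Qed.

Lemma peakon_mx_pos (q : 'rV[R]_2) : Omega q -> forall v : 'rV[R]_2, v != 0 ->
  0 < (v *m peakon_mx q *m v^T) 0 0.
Proof.
move=> Uq v v0.
have t0 : 0 < q 0 0 - q 0 1 by rewrite subr_gt0.
have X1 : 0 < 1 - expR (- L q) ^+ 2.
  by rewrite subr_gt0 expr_lt1 ?expR_ge0// expR_lt1 oppr_lt0.
rewrite !mxE !big_ord_recl !big_ord0 !mxE !big_ord_recl !big_ord0 !addr0.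
rewrite (_ : lift _ _ = 1); last exact: val_inj.
rewrite !peakon_mxE// /phi /= hornerC hornerX.
rewrite !expr1 !expr0 sqrrN expr1n.
set X := expR (- L q) in X1 *; set W := _^-1; set a := v 0 ord0; set b := v 0 1.
rewrite (_ : _ + _ = ((a - b * X) ^+ 2 + b ^+ 2 * (1 - X ^+ 2)) * W); last ring.
apply: mulr_gt0; last by rewrite invr_gt0.
have [b0|b0] := eqVneq b 0; last first.
  by rewrite ltr_wpDl ?sqr_ge0// mulr_gt0// exprn_even_gt0.
rewrite b0 mul0r subr0 expr0n mul0r addr0 exprn_even_gt0//=.
apply: contra_neq v0 => a0; apply/rowP => i; rewrite mxE.
by case: (ord2P i) => ->.
Qed.

End smoothness.

Definition peakon_metric (R : realType) : riemannian_metric (@Omega R) :=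
  RiemannianMetric (@Omega_open R) (@peakon_mx_smooth R)
    (fun q _ => peakon_mx_sym q) (@peakon_mx_pos R).

(* Main.v *)
Require Import Defs.
From mathcomp Require Import all_boot all_order all_algebra.
From mathcomp Require Import ring.
From mathcomp Require Import all_classical all_reals all_analysis.

Set Implicit Arguments.
Unset Strict Implicit.
Unset Printing Implicit Defensive.

Import Order.TTheory GRing.Theory Num.Theory.
Import numFieldNormedType.Exports.

Local Open Scope classical_set_scope.
Local Open Scope ring_scope.

(** The metric depends on [q] only through [t = q_1 - q_2], so on [Omega] every
    partial derivative is an ordinary one: [d/dq_1 = d/dt] and
    [d/dq_2 = - d/dt] ([partial_gap]).  Put [X = exp (- t)], which lies
    strictly between 0 and 1 and satisfies [dX/dt = - X].  All quantities are
    then rational in [X], with the indices [i, j, k] ranging over 0, 1: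
      - the metric is [g_ij = (-1)^(i+j) X^[i != j] / (1 - X^2)], its
        determinant is [1 / (1 - X^2)] and its inverse is [X^[i != j]];
      - the Christoffel symbols are the signed monomials
          [Gamma^k_ij = - (-1)^(i+j+k) X^(1 + [i = k] + [j = k])
                        / ((1 - X) (1 + X)^2)]
        ([christoffel_peakon]), since a factor [1 - X] cancels in each.
    Both the metric and the Christoffel symbols have the shape [X^n / D (t)],
    whose derivative is the function itself times a logarithmic derivative
    ([is_derive_decayX_over]).  Substituting into the curvature tensor leaves an
    identity of rational functions in [X], and the curvature is
      [X (1 - 2 X) / (1 + X)^2 = (e^t - 2) / (e^t + 1)^2].
    The denominator is positive, so the sign is that of [e^t - 2], that is, of
    [t - ln 2]. *)

(** * The two variables [t] and [X] *)

Definition gap (R : realType) (q : 'rV[R]_2) : R := q 0 0 - q 0 1.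

Definition decay (R : realType) (t : R) : R := expR (- t).

Lemma decay_gt0 (R : realType) (t : R) : 0 < decay t.
Proof. exact: expR_gt0. Qed.

Lemma decay_lt1 (R : realType) (t : R) : 0 < t -> decay t < 1.
Proof. by move=> t0; rewrite /decay expR_lt1 oppr_lt0. Qed.

Lemma decay_neq (R : realType) (t : R) : 0 < t ->
  [/\ decay t != 0, 1 - decay t != 0 & 1 + decay t != 0].
Proof.
move=> t0; have X0 := decay_gt0 t; have X1 := decay_lt1 t0.
by split; [rewrite gt_eqF | rewrite subr_eq0 gt_eqF | rewrite gt_eqF ?addr_gt0].
Qed.

(** * Sums and determinants of size two *)

Lemma ord2P (P : 'I_2 -> Prop) : P 0 -> P 1 -> forall i, P i.
Proof.
move=> P0 P1 [[|[|//]] Hi].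
  by rewrite (_ : Ordinal Hi = 0) //; apply: val_inj.
by rewrite (_ : Ordinal Hi = 1) //; apply: val_inj.
Qed.

Lemma sum_ord2 (V : zmodType) (F : 'I_2 -> V) : \sum_(i < 2) F i = F 0 + F 1.
Proof.
by rewrite !big_ord_recl big_ord0 addr0; congr (F _ + F _); apply: val_inj.
Qed.

Lemma det_ord2 (K : comNzRingType) (A : 'M[K]_2) :
  \det A = A 0 0 * A 1 1 - A 0 1 * A 1 0.
Proof.
rewrite (expand_det_row _ 0) sum_ord2 /cofactor !det_mx11 !mxE /=.
rewrite (_ : lift 0 0 = 1); last exact: val_inj.
rewrite (_ : lift 1 0 = 0); last exact: val_inj.
by rewrite expr0 expr1; ring.
Qed.

(** * Derivatives of functions of the gap *)

(** [gap] is affine with slope [(-1) ^+ i] along the [i]-th axis, and a partial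
    derivative at a point of the open set [Omega] only sees the values of [f]
    nearby.  So a formula for [f] on [Omega] alone is enough; those for the metric
    and its Christoffel symbols fail where [q_1 <= q_2]. *)
Lemma partial_gap (R : realType) (f : 'rV[R]_2 -> R) (h : R -> R) (d : R)
    (i : 'I_2) (q : 'rV[R]_2) :
  Omega q -> (forall x, Omega x -> f x = h (gap x)) ->
  is_derive (gap q) (1 : R) h d ->
  partial i f q = (-1) ^+ i * d.
Proof.
move=> Uq fE [dh hd].
have near_fE : {near q, f =1 h \o @gap R}.
  have : \forall x \near q, Omega x.
    by apply: open_nbhs_nbhs; split=> //; exact: Omega_open.
  by apply: filterS => x /fE.
rewrite /partial (near_eq_derive _ near_fE).
have -> : 'D_(delta_mx 0 i) (h \o @gap R) q = 'D_((-1) ^+ i) h (gap q).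
  have gapE s : gap (s *: delta_mx 0 i + q) = s *: (-1) ^+ i + gap q.
    rewrite /gap !mxE /GRing.scale /=.
    by move: i; apply: ord2P => /=; ring.
  rewrite /derive; congr (fun F => lim (F @ 0^')); apply/funext => s /=.
  by rewrite gapE.
(* differentiability of [h] makes its directional derivative linear in the
   direction, so that the slope factors out *)
have diffh : differentiable h (gap q) by exact/derivable1_diffP.
rewrite deriveE // -hd deriveE //.
by rewrite -[X in 'd _ _ X = _]mulr1 [_ * 1](_ : _ = (-1) ^+ i *: 1) // linearZ.
Qed.

Lemma is_derive_decayX (R : realType) (n : nat) (t : R) :
  is_derive t (1 : R) (fun t => decay t ^+ n) (- n%:R * decay t ^+ n).
Proof.
have -> : (fun t : R => decay t ^+ n) = (fun t : R => expR ((- n%:R) * t)).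
  by apply/funext => u; rewrite /decay -expRM_natl mulrN mulNr.
rewrite (_ : decay t ^+ n = expR (- n%:R * t)); last first.
  by rewrite /decay -expRM_natl mulrN mulNr.
rewrite mulrC.
apply: (@is_derive1_comp _ expR (fun t : R => - n%:R * t)).
apply: (is_derive_eq (is_deriveZ (- n%:R) (is_derive_id t (1 : R)))).
by rewrite /GRing.scale /= mulr1.
Qed.

(** The derivative is left as a multiple of the function, its logarithmic
    derivative being [- n - D' / D]: the exponent [n] stays a parameter, and one
    formula serves all index combinations at once. *)
Lemma is_derive_decayX_over (R : realType) (n : nat) (D : R -> R) (d t : R) :
  is_derive t (1 : R) D d -> D t != 0 ->
  is_derive t (1 : R) (fun t => decay t ^+ n / D t)
    (decay t ^+ n / D t * (- n%:R - d / D t)).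
Proof.
move=> dD D0.
have dV : is_derive t (1 : R) (fun t => (D t)^-1) (- (D t) ^- 2 * d).
  case: dD => D1 D2; apply: DeriveDef; first exact: derivableV.
  by rewrite deriveV // D2.
apply: (is_derive_eq (is_deriveM (is_derive_decayX n t) dV)).
by rewrite /GRing.scale /=; field.
Qed.

(** * The metric, its inverse and its derivatives *)

Definition metric_denom (R : realType) (t : R) : R := 1 - decay t ^+ 2.

Lemma metric_denomE (R : realType) (t : R) :
  metric_denom t = (1 - decay t) * (1 + decay t).
Proof. by rewrite /metric_denom; ring. Qed.

Lemma metric_denom_gt0 (R : realType) (t : R) : 0 < t -> 0 < metric_denom t.
Proof.
move=> /decay_lt1 X1; rewrite subr_gt0 expr_lt1 //.
exact: ltW (decay_gt0 t).
Qed.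

Lemma peakon_metricE (R : realType) (q : 'rV[R]_2) (i j : 'I_2) : Omega q ->
  peakon_metric R q i j =
    (-1) ^+ (i + j) * (decay (gap q) ^+ (i != j) / metric_denom (gap q)).
Proof.
move=> Uq; rewrite [LHS]peakon_mxE // expr1 -/(gap q) /metric_denom /decay.
by case: (i == j); rewrite ?hornerC ?hornerX ?expr0 ?expr1.
Qed.

(** The inverse is the peakon matrix [exp (- |q_i - q_j|)]: the off-diagonal
    entries are [exp (- t)] because [q_1 > q_2]. *)
Lemma peakon_metric_inv (R : realType) (q : 'rV[R]_2) (i j : 'I_2) : Omega q ->
  invmx (peakon_metric R q) i j = decay (gap q) ^+ (i != j).
Proof.
move=> Uq; set E := \matrix_(i, j) decay (gap q) ^+ (i != j) : 'M[R]_2.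
have nz : metric_denom (gap q) != 0.
  by rewrite gt_eqF // metric_denom_gt0 // subr_gt0.
have gE : peakon_metric R q *m E = 1%:M.
  apply/matrixP; elim/ord2P; elim/ord2P;
    rewrite !mxE sum_ord2 !peakon_metricE // !mxE /= /metric_denom in nz *;
    by field.
have [ug _] := mulmx1_unit gE.
have -> : invmx (peakon_metric R q) = E.
  by rewrite -[RHS]mul1mx -(mulVmx ug) -mulmxA gE mulmx1.
by rewrite mxE.
Qed.

Lemma det_peakon_metric (R : realType) (q : 'rV[R]_2) : Omega q ->
  \det (peakon_metric R q) = (metric_denom (gap q))^-1.
Proof.
move=> Uq.
have nz : metric_denom (gap q) != 0.
  by rewrite gt_eqF // metric_denom_gt0 // subr_gt0.
rewrite det_ord2 !peakon_metricE //= /metric_denom in nz *.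
by field.
Qed.

Lemma partial_peakon_metric (R : realType) (q : 'rV[R]_2) (k i j : 'I_2) :
  Omega q ->
  partial k (fun x => peakon_metric R x i j) q =
    (-1) ^+ (k + i + j) * (decay (gap q) ^+ (i != j) / metric_denom (gap q)
      * (- (i != j)%:R - 2 * decay (gap q) ^+ 2 / metric_denom (gap q))).
Proof.
move=> Uq; have t0 : 0 < gap q by rewrite subr_gt0.
have dD : is_derive (gap q) (1 : R) (@metric_denom R) (2 * decay (gap q) ^+ 2).
  apply: (is_derive_eq (is_deriveB (is_derive_cst (1 : R) (gap q) 1)
    (is_derive_decayX 2 (gap q)))).
  by ring.
have D0 : metric_denom (gap q) != 0 by rewrite gt_eqF // metric_denom_gt0.
have dg := is_deriveZ ((-1) ^+ (i + j)) (is_derive_decayX_over (i != j) dD D0).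
rewrite (partial_gap k Uq (fun x Ux => peakon_metricE i j Ux) dg).
by rewrite -addnA [in RHS]exprD -[RHS]mulrA.
Qed.

(** * Christoffel symbols and curvature *)

Definition christoffel_denom (R : realType) (t : R) : R :=
  (1 - decay t) * (1 + decay t) ^+ 2.

Lemma christoffel_denom_gt0 (R : realType) (t : R) :
  0 < t -> 0 < christoffel_denom t.
Proof.
move=> t0; have X0 := decay_gt0 t; have X1 := decay_lt1 t0.
by rewrite mulr_gt0 ?subr_gt0 // exprn_gt0 // addr_gt0.
Qed.

(** With [X = decay (gap q)], the Koszul formula gives polynomials in [X] over
    [(1 - X^2)^2]; each numerator is a signed monomial times [1 - X], and the
    exponent of the monomial is one more than the number of lower indices equal
    to the upper one.  This uniform shape is what lets the symbols be differentiated once more with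
    [is_derive_decayX_over]. *)
Lemma christoffel_peakon (R : realType) (q : 'rV[R]_2) (k i j : 'I_2) :
  Omega q ->
  christoffel (peakon_metric R) k i j q =
    - (-1) ^+ (i + j + k) *
    (decay (gap q) ^+ (1 + (i == k) + (j == k)) / christoffel_denom (gap q)).
Proof.
move=> Uq; have t0 : 0 < gap q by rewrite subr_gt0.
have [nz0 nz1 nz2] := decay_neq t0.
rewrite /christoffel sum_ord2 !peakon_metric_inv // !partial_peakon_metric //.
rewrite !metric_denomE /christoffel_denom.
move: (decay (gap q)) nz1 nz2 => X nz1 nz2.
by elim/ord2P: k; elim/ord2P: i; elim/ord2P: j => /=; field; rewrite nz1 nz2.
Qed.

Lemma partial_christoffel_peakon (R : realType) (q : 'rV[R]_2)
    (h k i j : 'I_2) (X := decay (gap q)) :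
  Omega q ->
  partial h (christoffel (peakon_metric R) k i j) q =
    - (-1) ^+ (h + i + j + k) *
    (X ^+ (1 + (i == k) + (j == k)) / christoffel_denom (gap q) *
     (- (1 + (i == k) + (j == k))%:R
      - X * (3 * X - 1) / ((1 - X) * (1 + X)))).
Proof.
move=> Uq; have t0 : 0 < gap q by rewrite subr_gt0.
have [_ nz1 nz2] := decay_neq t0.
have dD : is_derive (gap q) (1 : R) (@christoffel_denom R)
    (X * (1 + X) * (3 * X - 1)).
  have -> : @christoffel_denom R = fun t =>
      1 + decay t ^+ 1 - decay t ^+ 2 - decay t ^+ 3.
    by apply/funext => t; rewrite /christoffel_denom; ring.
  have dX n := is_derive_decayX n (gap q).
  apply: (is_derive_eq (is_deriveB (is_deriveB (is_deriveD
    (is_derive_cst (1 : R) (gap q) 1) (dX 1)) (dX 2)) (dX 3))).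
  by rewrite -/X; ring.
have D0 : christoffel_denom (gap q) != 0.
  by rewrite gt_eqF // christoffel_denom_gt0.
have dlogD : X * (1 + X) * (3 * X - 1) / christoffel_denom (gap q) =
    X * (3 * X - 1) / ((1 - X) * (1 + X)).
  by rewrite /christoffel_denom -/X; field; rewrite nz1 nz2.
have dG := is_deriveZ (- (-1) ^+ (i + j + k))
  (is_derive_decayX_over (1 + (i == k) + (j == k)) dD D0).
rewrite (partial_gap h Uq (fun x Ux => christoffel_peakon k i j Ux) dG) dlogD.
rewrite -(addnA h i j) -(addnA h) [in RHS]exprD /GRing.scale /= -/X.
by rewrite !mulNr mulrN mulrA.
Qed.

(** Everything is now explicit in [X = decay (gap q)], and [exp t = X^-1], so
    both sides are rational functions of [X] without poles in the range of [X];
    clearing denominators proves them equal. *)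
Lemma gauss_curvature_peakon (R : realType) (q : 'rV[R]_2) : Omega q ->
  gauss_curvature (peakon_metric R) q =
    (expR (gap q) - 2) / (expR (gap q) + 1) ^+ 2.
Proof.
move=> Uq; have t0 : 0 < gap q by rewrite subr_gt0.
have [nz0 nz1 nz2] := decay_neq t0.
have -> : expR (gap q) = (decay (gap q))^-1 by rewrite /decay expRN invrK.
rewrite /gauss_curvature /riemann_low /riemann !sum_ord2.
rewrite !partial_christoffel_peakon // !christoffel_peakon //.
rewrite !peakon_metricE // det_peakon_metric // !metric_denomE /christoffel_denom.
move: (decay (gap q)) nz0 nz1 nz2 => X nz0 nz1 nz2 /=.
by field; rewrite nz0 nz1 nz2.
Qed.

Theorem lemma3p1 (R : realType) :
  (forall q : 'rV[R]_2, Omega q ->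
     gauss_curvature (peakon_metric R) q =
       (expR (q 0 0 - q 0 1) - 2) /
       (expR (2 * (q 0 0 - q 0 1)) + 2 * expR (q 0 0 - q 0 1) + 1)) /\
  (forall q : 'rV[R]_2, Omega q ->
     [/\ q 0 0 - q 0 1 > ln 2 -> gauss_curvature (peakon_metric R) q > 0,
         q 0 0 - q 0 1 = ln 2 -> gauss_curvature (peakon_metric R) q = 0
       & q 0 0 - q 0 1 < ln 2 -> gauss_curvature (peakon_metric R) q < 0]).
Proof.
split=> q Uq; rewrite gauss_curvature_peakon // /gap.
  congr (_ / _); rewrite expRM_natl; ring.
have expR_ln2 : expR (ln 2) = 2 :> R by rewrite lnK // posrE.
have den_gt0 : 0 < ((expR (q 0 0 - q 0 1) + 1) ^+ 2)^-1.
  by rewrite invr_gt0 exprn_gt0 // addr_gt0 // expR_gt0.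
split=> [lt2|->|lt2].
- by rewrite pmulr_lgt0 // subr_gt0 -expR_ln2 ltr_expR.
- by rewrite expR_ln2 subrr mul0r.
- by rewrite pmulr_llt0 // subr_lt0 -expR_ln2 ltr_expR.
Qed.
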